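(* For integers $m\geq 1$ and $p\geq 0$, \[ \sum_{n=1}^\infty\frac{H_n^{(m+1)}\binom{2n}{n}}{4^n n^{p+1}} =4\,\zeta(\bar{1},\{\hat{1}\}_p,\hat{2},\{\hat{1}\}_{m-1}) -2\,\zeta(m+1)\,\zeta(\bar{1},\{\hat{1}\}_p)\,. \]
   Context: $H_n^{(s)}=\sum_{k=1}^n k^{-s}$ is the generalized harmonic number and $\zeta(s)$ the Riemann zeta function. Mixed multiple zeta values: for positive integers $s_1,\dots,s_r$, each possibly decorated by a bar, hat or tilde, $\zeta(s_1,\dots,s_r):=\sum_{n_1>n_2>\cdots>n_r\geq 1}\prod_{j=1}^r \frac{\epsilon_j(n_j)}{n_j^{s_j}}$, where $\epsilon_j(n)=1$ for undecorated $s_j$, $(-1)^n$ for $\bar s_j$, $1+(-1)^n$ for $\hat s_j$, and $1-(-1)^n$ for $\tilde s_j$. $\{a\}_k$ denotes $k$ repetitions of $a$ ($\{a\}_0$ is empty). *)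

(* Defs.v *)
From mathcomp Require Import all_boot all_order all_algebra.
From mathcomp Require Import all_classical all_reals all_analysis.

Set Implicit Arguments.
Unset Strict Implicit.
Unset Printing Implicit Defensive.

Import Order.TTheory GRing.Theory Num.Theory.
Import numFieldNormedType.Exports.

Local Open Scope classical_set_scope.
Local Open Scope ring_scope.

Definition gen_harmonic (R : realType) (s n : nat) : R :=
  \sum_(1 <= k < n.+1) (k%:R ^+ s)^-1.

Inductive decoration := Plain | Bar | Hat | Tilde.

Definition mzv_sign (R : realType) (d : decoration) (n : nat) : R :=
  match d with
  | Plain => 1
  | Bar => (-1) ^+ n
  | Hat => 1 + (-1) ^+ n
  | Tilde => 1 - (-1) ^+ n
  end.

Definition mzv_index : Type := (decoration * nat)%type.

Definition plain (s : nat) : mzv_index := (Plain, s).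
Definition bar (s : nat) : mzv_index := (Bar, s).
Definition hat (s : nat) : mzv_index := (Hat, s).
Definition tilde (s : nat) : mzv_index := (Tilde, s).

(* The finite sum over N > n_1 > n_2 > ... > n_r >= 1. *)
Fixpoint mzv_below (R : realType) (s : seq mzv_index) (N : nat) : R :=
  match s with
  | [::] => 1
  | (d, a) :: s' =>
      \sum_(1 <= n < N) mzv_sign R d n / n%:R ^+ a * mzv_below R s' n
  end.

(* A leading barred 1 gives a series that converges only conditionally: it is
   summed in increasing order of n_1.  The value is meaningful only when
   [mzv_below R s] converges; [mzv R [:: plain s]] is the Riemann zeta value at
   the integer [s]. *)
Definition mzv (R : realType) (s : seq mzv_index) : R := limn (mzv_below R s).

(* Main.v *)
(* The proof is a connected-sum argument.  With the connector
   C(n, b) = n! b! / (n + b)!, symmetric in n and b, telescoping gives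
   C(n, b) / n = \sum_(i > b) C(n, i) / i for n > 0.  Starting from C(n, 0) = 1,
   this moves each factor 1/n of the left-hand side to a new summation index
   i, and the symmetric relation turns the tail \sum_(k > n) k^-(m+1)
   into the squared factor carried by the hatted 2.  The weights
   a_n = binom(2n, n) / 4^n then disappear because \sum_(n > 0) a_n C(n, b) =
   1 / (2b - 1) for b > 0, which makes \sum_(n > 0) a_n C(n, b) / n equal to
   \sum_(i > b) 1 / (i (2i - 1)); this is -2 times the sum of (-1)^n_1 / n_1
   over n_1 > 2b, with the terms n_1 = 2i - 1 and n_1 = 2i paired.
   Every interchange concerns nonnegative double series.  Finally H_n^(m+1) is zeta(m+1) minus the tail. *)

Require Import Defs.
From mathcomp Require Import all_boot all_order all_algebra.
From mathcomp Require Import all_classical all_reals all_analysis.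
From mathcomp Require Import zify ring lra.

Set Implicit Arguments.
Unset Strict Implicit.
Unset Printing Implicit Defensive.

Import Order.TTheory GRing.Theory Num.Theory.
Import numFieldNormedType.Exports.

Local Open Scope classical_set_scope.
Local Open Scope ring_scope.

(** * Sums of real series and interchange of nonnegative double series *)

Definition has_sum (R : realType) (f : R ^nat) (c : R) := series f @ \oo --> c.

Lemma eq_has_sum (R : realType) (f g : R ^nat) (c : R) :
  f =1 g -> has_sum f c -> has_sum g c.
Proof. by move=> /funext ->. Qed.

Lemma has_sumZ (R : realType) (f : R ^nat) (c k : R) :
  has_sum f c -> has_sum (fun n => k * f n) (k * c).
Proof.
move=> fc; rewrite /has_sum [X in X @ _](_ : _ = fun n => k * series f n).
  exact: cvgMl_tmp.
by apply/funext => n; rewrite /series /= mulr_sumr.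
Qed.

Arguments has_sumZ {R f c} k _.

Lemma has_sumB (R : realType) (f g : R ^nat) (c d : R) :
  has_sum f c -> has_sum g d -> has_sum (fun n => f n - g n) (c - d).
Proof.
move=> fc gd; rewrite /has_sum.
rewrite [X in X @ _](_ : _ = fun n => series f n - series g n); first exact: cvgB.
by apply/funext => n; rewrite /series /= sumrB.
Qed.

Lemma has_sum_finite (R : realType) (f : R ^nat) (N : nat) :
  (forall n, (N <= n)%N -> f n = 0) -> has_sum f (\sum_(0 <= n < N) f n).
Proof.
move=> f0; rewrite /has_sum -(cvg_shiftn N).
rewrite [X in X @ _](_ : _ = cst (\sum_(0 <= n < N) f n)); first exact: cvg_cst.
apply/funext => n; rewrite /series /= (@big_cat_nat _ _ _ N) ?leq_addl//=.
by rewrite [X in _ + X]big_nat_cond [X in _ + X]big1 ?addr0// => i /andP[/andP[/f0]].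
Qed.

Lemma has_sum0 (R : realType) : has_sum (fun=> 0 : R) 0.
Proof. by have := @has_sum_finite R (fun=> 0) 0; rewrite big_nil; apply. Qed.

Arguments has_sum0 R : clear implicits.

Lemma has_sum_le (R : realType) (f g : R ^nat) (d : R) :
  (forall n, 0 <= f n <= g n) -> has_sum g d -> has_sum f (limn (series f)).
Proof.
move=> fg /cvgP gd; apply: (series_le_cvg _ _ _ gd) => n.
- by case/andP: (fg n).
- by case/andP: (fg n); exact: le_trans.
- by case/andP: (fg n).
Qed.

(** Passing to the extended reals gives access to sums of nonnegative terms that always exist. *)
Lemma has_sum_nneseries (R : realType) (f : R ^nat) (c : R) :
  (forall n, 0 <= f n) ->
  has_sum f c <-> (\sum_(n <oo) (f n)%:E)%E = c%:E.
Proof.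
move=> f0.
have E : (fun n => \sum_(0 <= i < n) (f i)%:E)%E = EFin \o series f.
  by apply/funext => n /=; rewrite sumEFin.
split=> [fc|fc].
  by rewrite E EFin_lim ?(cvg_lim _ fc)//; apply/cvg_ex; exists c.
have : (fun n => \sum_(0 <= i < n) (f i)%:E)%E @ \oo --> c%:E.
  by rewrite -fc; apply: is_cvg_nneseries => n _ _; rewrite lee_fin.
by rewrite E => /fine_cvgP[_].
Qed.

Lemma has_sum_ge0 (R : realType) (f : R ^nat) (c : R) :
  (forall n, 0 <= f n) -> has_sum f c -> 0 <= c.
Proof.
move=> f0 /(has_sum_nneseries _ f0) fc; rewrite -lee_fin -fc.
by apply: nneseries_ge0 => n _ _; rewrite lee_fin.
Qed.

(** Tonelli for series. Only the total of [u] has to be known: the convergence of the series of [v]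
    is part of the conclusion. *)
Lemma has_sum_exchange (R : realType) (f : nat -> nat -> R) (u v : R ^nat)
    (c : R) :
  (forall i j, 0 <= f i j) ->
  (forall i, has_sum (f i) (u i)) -> (forall j, has_sum (f ^~ j) (v j)) ->
  has_sum u c -> has_sum v c.
Proof.
move=> f0 fu fv uc.
have u0 i : 0 <= u i by apply: has_sum_ge0 (fu i).
have v0 j : 0 <= v j by apply: has_sum_ge0 (fv j) => n; exact: f0.
apply/has_sum_nneseries => //; move/(has_sum_nneseries _ u0): uc => <-.
under eq_eseriesr => j _.
  by rewrite -(iffLR (has_sum_nneseries _ _) (fv j))//; over.
rewrite nneseries_interchange; last by move=> i j; rewrite lee_fin.
apply: eq_eseriesr => i _; exact/has_sum_nneseries.
Qed.

Lemma has_sum_telescope (R : realType) (g : R ^nat) (n : nat) :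
  g @ \oo --> 0 -> has_sum (fun i => (n < i)%:R * (g i.-1 - g i)) (g n).
Proof.
move=> g0; rewrite /has_sum -(cvg_shiftn n.+1).
rewrite [X in X @ _](_ : _ = fun k => g n - g (k + n)%N).
  have : (fun k => g n - g (k + n)%N) @ \oo --> g n - 0.
    by apply: cvgB; [exact: cvg_cst | rewrite cvg_shiftn].
  by rewrite subr0.
apply/funext => k; rewrite /series /= addnS.
elim: k => [|k ih].
  rewrite big_nat_cond big1 ?subrr// => i /andP[/andP[_ lti] _].
  by rewrite ltnNge -ltnS lti mul0r.
rewrite addSn big_nat_recr//= ih -addSn ltnS leq_addl mul1r /=.
by rewrite addSn; ring.
Qed.

Arguments has_sum_telescope {R g} n _.

(** * The connector and its telescoping relation *)

Definition connector (R : realType) (n b : nat) : R := ('C(n + b, b)%:R)^-1.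

Lemma connector_ge0 (R : realType) n b : 0 <= connector R n b.
Proof. by rewrite invr_ge0. Qed.

Lemma connectorC (R : realType) n b : connector R n b = connector R b n.
Proof. by rewrite /connector -bin_sub ?leq_addl// addnK addnC. Qed.

Lemma connectorn0 (R : realType) n : connector R n 0 = 1.
Proof. by rewrite /connector bin0 invr1. Qed.

Lemma connectorS (R : realType) n b :
  b.+1%:R * connector R n b = (n + b.+1)%:R * connector R n b.+1.
Proof.
rewrite /connector addnS.
have := mul_bin_diag (n + b).+1 b => /= /(congr1 (fun k => k%:R : R)).
rewrite !natrM => E.
have c0 : 'C(n + b, b)%:R != 0 :> R by rewrite pnatr_eq0 -lt0n bin_gt0 leq_addl.
have c1 : 'C((n + b).+1, b.+1)%:R != 0 :> R.
  by rewrite pnatr_eq0 -lt0n bin_gt0 ltnS leq_addl.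
by apply: (mulIf c0); apply: (mulIf c1); rewrite divfK// mulrAC divfK// E.
Qed.

Lemma connectorB (R : realType) n b :
  connector R n b - connector R n b.+1 = n%:R / b.+1%:R * connector R n b.+1.
Proof.
have b0 : b.+1%:R != 0 :> R by rewrite pnatr_eq0.
apply: (mulfI b0); rewrite mulrBr connectorS natrD.
by rewrite mulrA [X in _ = X * _]mulrC divfK//; ring.
Qed.

(** The case [n = 1] is an equality, and the binomial coefficient grows with [n]. *)
Lemma connector_le (R : realType) n b : (0 < n)%N -> connector R n b <= b.+1%:R^-1.
Proof.
case: n => // n _; rewrite /connector.
rewrite lef_pV2 ?posrE ?ltr0n ?bin_gt0 ?leq_addl// ler_nat.
elim: n => [|n ih]; first by rewrite add1n binSn.
apply: leq_trans ih _; rewrite addSn [in X in (_ <= X)%N]addSn.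
by apply: leq_bin2l.
Qed.

Lemma cvg_connector (R : realType) n : (0 < n)%N -> connector R n @ \oo --> 0.
Proof.
move=> n0; apply: (@squeeze_cvgr _ _ _ _ (cst 0) (@harmonic R)).
- by apply: nearW => b; rewrite connector_ge0 /= connector_le.
- exact: cvg_cst.
- exact: cvg_harmonic.
Qed.

(** By [connectorB], each term is [n^-1] times the difference of two consecutive connectors, so the
    sum telescopes. *)
Lemma has_sum_connector (R : realType) n b : (0 < n)%N ->
  has_sum (fun i => (b < i)%:R * (connector R n i / i%:R)) (connector R n b / n%:R).
Proof.
move=> n0; have nz : n%:R != 0 :> R by rewrite pnatr_eq0 -lt0n.
rewrite [_ / n%:R]mulrC.
apply: eq_has_sum (has_sumZ _ (has_sum_telescope b (cvg_connector n0))).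
case=> [|i]; first by rewrite !mul0r mulr0.
rewrite connectorB /=; have : i.+1%:R != 0 :> R by rewrite pnatr_eq0.
by move: (i.+1%:R) => k k0; field; rewrite nz k0.
Qed.
Arguments has_sum_connector R {n} b _.

(** * Central binomial weights and their sum against the connector *)

(* Set to 0 at [n = 0] so that series may be indexed from 0. *)
Definition central (R : realType) (n : nat) : R :=
  (0 < n)%:R * ('C(2 * n, n)%:R / 4 ^+ n).

Lemma central_ge0 (R : realType) n : 0 <= central R n.
Proof. by rewrite /central mulr_ge0// divr_ge0// exprn_ge0. Qed.

Lemma centralS (R : realType) n : (0 < n)%N ->
  central R n.+1 = (2 * n + 1)%:R / (2 * n + 2)%:R * central R n.
Proof.
move=> n0; rewrite /central n0 !mul1r.
have E : (n.+1 * 'C(2 * n.+1, n.+1) = 2 * (2 * n + 1) * 'C(2 * n, n))%N.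
  (* Two absorption identities lower [2n + 2] to [2n]; the symmetry [h3] of row [2n + 1] chains
     them, after multiplication by [n + 1]. *)
  have h1 := mul_bin_diag (2 * n).+2 n; have h2 := mul_bin_diag (2 * n).+1 n.
  have h3 : ('C((2 * n).+1, n.+1) = 'C((2 * n).+1, n))%N.
    by rewrite -bin_sub; [congr 'C(_, _); lia | lia].
  rewrite /= in h1 h2; rewrite mulnS add2n -h1.
  have : (n.+1 * (2 * n).+2 * 'C((2 * n).+1, n) =
    n.+1 * (2 * (2 * n + 1) * 'C(2 * n, n)))%N by nia.
  nia.
have {}E := congr1 (fun k => k%:R : R) E.
rewrite /= !natrM in E.
have n1 : n.+1%:R != 0 :> R by rewrite pnatr_eq0.
have -> : 'C(2 * n.+1, n.+1)%:R = 2 * (2 * n + 1)%:R * 'C(2 * n, n)%:R / n.+1%:R :> R.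
  by rewrite -E mulrC mulKf.
have -> : (2 * n + 2)%:R = 2 * n.+1%:R :> R by rewrite -natrM mulnS addnC.
have n4 : 4 ^+ n != 0 :> R by rewrite expf_neq0// pnatr_eq0.
rewrite exprS; move: n1 n4; move: (n.+1%:R) (4 ^+ n) => x y x0 y0.
by field; rewrite x0 y0.
Qed.

Lemma central_bound (R : realType) n : (central R n) ^+ 2 <= n.+1%:R^-1.
Proof.
rewrite -[_^-1]mul1r ler_pdivlMr ?ltr0n//.
(* The factor [2n + 1] makes the induction work: from [n = 1] on the product decreases, since
   [(2n + 1)(2n + 3) <= (2n + 2)^2]. *)
suff : (central R n) ^+ 2 * (2 * n + 1)%:R <= 1.
  apply: le_trans; apply: ler_wpM2l; first exact: sqr_ge0.
  by rewrite ler_nat; lia.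
elim: n => [|n ih]; first by rewrite /central mul0r expr0n mul0r ler01.
case: n ih => [|n] ih.
  by rewrite /central mul1r (_ : 'C(2 * 1, 1) = 2)//; lra.
apply: le_trans ih; rewrite centralS//.
set a := central _ _; set k := n.+1.
have -> : (2 * k.+1 + 1)%:R = (2 * k%:R + 3) :> R.
  by rewrite (_ : (2 * k.+1 + 1 = 2 * k + 3)%N) ?natrD ?natrM//; lia.
rewrite !natrD natrM.
have k0 : 0 <= k%:R :> R by [].
have d0 : 0 < 2 * k%:R + 2 :> R by lra.
rewrite exprMn mulrAC [X in _ <= X]mulrC; apply: ler_wpM2r; first exact: sqr_ge0.
rewrite expr_div_n mulrAC ler_pdivrMr ?exprn_gt0//.
nra.
Qed.

Lemma cvg_central (R : realType) : central R @ \oo --> 0.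
Proof.
have sq : (fun n => central R n ^+ 2) @ \oo --> 0.
  apply: (@squeeze_cvgr _ _ _ _ (cst 0) (@harmonic R)).
  - by apply: nearW => b; rewrite sqr_ge0 central_bound.
  - exact: cvg_cst.
  - exact: cvg_harmonic.
apply/cvgr0Pnorm_lt => e e0.
move/cvgr0Pnorm_lt : sq => /(_ (e ^+ 2)); rewrite exprn_gt0// => /(_ isT).
apply: filterS => n; rewrite normrX ltr_pXn2r ?nnegrE ?normr_ge0 ?ltW//.
Qed.

(* Gosper's certificate: the summand telescopes against
   [2 (n + b) / (2 b - 1)] times itself. *)
Lemma has_sum_central_connector (R : realType) b : (0 < b)%N ->
  has_sum (fun n => central R n * connector R n b) (2 * b%:R - 1)^-1.
Proof.
case: b => // b _.
have b0 : 2 * b.+1%:R - 1 != 0 :> R.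
  by rewrite -natrM mulnS add2n -addn1 natrD addrK pnatr_eq0.
(* By [connectorS], [G n] is [n + b.+1] times the summand; this form shows that [G] tends to 0. The
   shift in [g] matches the differences [g i.-1 - g i] of [has_sum_telescope]. *)
pose G n : R := central R n * (b.+1%:R * connector R n b).
pose g n : R := 2 / (2 * b.+1%:R - 1) * G n.+1.
have G0 : G @ \oo --> 0.
  apply: (@squeeze_cvgr _ _ _ _ (cst 0) (central R)).
  - near=> n; rewrite /G mulr_ge0 ?central_ge0 ?mulr_ge0 ?connector_ge0//=.
    rewrite ler_piMr ?central_ge0// -ler_pdivlMl ?ltr0n// mulr1.
    by apply: connector_le; near: n; exact: nbhs_infty_gt.
  - exact: cvg_cst.
  - exact: cvg_central.
have g0 : g @ \oo --> 0.
  rewrite -(mulr0 (2 / (2 * b.+1%:R - 1))); apply: cvgMl_tmp.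
  have := G0; rewrite -(cvg_shiftn 1).
  by under eq_fun do rewrite addn1.
have <- : g 0%N = (2 * b.+1%:R - 1)^-1.
  have -> : g 0%N = 2 / (2 * b.+1%:R - 1) * (2^-1 * (b.+1%:R / b.+1%:R)).
    rewrite /g /G /central /connector add1n binSn muln1 (_ : 'C(2, 1) = 2)//.
    by rewrite mul1r; congr (_ * (_ * _)); lra.
  by rewrite divff ?pnatr_eq0// mulr1 mulrAC divff ?mul1r// pnatr_eq0.
apply: eq_has_sum (has_sum_telescope 0 g0) => -[|i].
  by rewrite /central !mul0r.
rewrite mul1r /= /g -mulrBr /G (@centralS _ i.+1)//.
(* Both sides are [(i + 2)! (b + 1)! / (i + b + 2)!]. *)
have -> : b.+1%:R * connector R i.+2 b = i.+2%:R * connector R i.+1 b.+1.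
  by rewrite connectorS [connector R i.+1 _]connectorC connectorS connectorC addnC.
have -> : (2 * i.+1 + 2)%:R = 2 * i.+2%:R :> R by rewrite -natrM; congr _%:R; lia.
have -> : (2 * i.+1 + 1)%:R = 2 * i.+2%:R - 1 :> R.
  by rewrite -natrM -[1]/(1%:R) -natrB; [congr _%:R; lia | lia].
have i2 : i.+2%:R != 0 :> R by rewrite pnatr_eq0.
rewrite connectorS (_ : (i.+1 + b.+1)%:R = i.+2%:R + b.+1%:R - 1); last first.
  by rewrite -natrD -[1]/(1%:R) -natrB; [congr _%:R; lia | lia].
move: i2 b0; move: (i.+2%:R) (b.+1%:R) (connector _ _ _) (central _ _) => x y c a.
by move=> x0 y0; field; rewrite x0 y0.
Unshelve. all: by end_near. Qed.
Arguments has_sum_central_connector R {b} _.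

(** * Weights of paired alternating terms and their tails *)

(* The terms [n = 2 i - 1] and [n = 2 i] of [(-1)^n / n] add up to half of
   [- pair_weight i]; at [i = 0] the junk value of the inverse is 0. *)
Definition pair_weight (R : realType) (i : nat) : R := (i%:R * (2 * i%:R - 1))^-1.

Lemma pair_weight_ge0 (R : realType) i : 0 <= pair_weight R i.
Proof.
rewrite invr_ge0; case: i => [|i]; first by rewrite mul0r.
by rewrite mulr_ge0// -natrM subr_ge0 ler1n.
Qed.

(** Comparison with the telescoping series of [2 / i - 2 / (i + 1)]. *)
Lemma has_sum_pair_weight (R : realType) :
  has_sum (pair_weight R) (limn (series (pair_weight R))).
Proof.
pose g i : R := 2 * harmonic i.
have g0 : g @ \oo --> 0.
  by rewrite -(mulr0 2); apply: cvgMl_tmp; exact: cvg_harmonic.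
apply: has_sum_le (has_sum_telescope 0 g0) => i.
rewrite pair_weight_ge0 /=; case: i => [|i].
  by rewrite /pair_weight !mul0r invr0.
have i1 : 1 <= i.+1%:R :> R by rewrite ler1n.
rewrite mul1r /g /harmonic /= -mulrBr -[i.+2]addn1 natrD /pair_weight.
move: (i.+1%:R : R) i1 => x x1.
have -> : 2 * (x^-1 - (x + 1)^-1) = (x * ((x + 1) / 2))^-1.
  by field; rewrite !gt_eqF//; lra.
rewrite lef_pV2 ?posrE; [|nra|nra].
by apply: ler_wpM2l; lra.
Qed.

Arguments has_sum_pair_weight R : clear implicits.

Definition pair_tail (R : realType) (b : nat) : R :=
  limn (series (fun i => (b < i)%:R * pair_weight R i)).

Lemma has_sum_pair_tail (R : realType) b :
  has_sum (fun i => (b < i)%:R * pair_weight R i) (pair_tail R b).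
Proof.
apply: has_sum_le (has_sum_pair_weight R) => i.
by case: ltnP => _; rewrite ?mul1r ?mul0r ?lexx pair_weight_ge0.
Qed.

Arguments has_sum_pair_tail R b : clear implicits.

(** Expanding [C(n, b) / n] over [i > b] gives a double sum whose inner sum over [n] is known from
    [has_sum_central_connector]. *)
Lemma has_sum_central_tail (R : realType) b :
  has_sum (fun n => central R n / n%:R * connector R n b) (pair_tail R b).
Proof.
pose f i n : R := (b < i)%:R * (central R n * connector R n i / i%:R).
apply: (@has_sum_exchange _ f _ _ _ _ _ _ (has_sum_pair_tail R b)).
- move=> i n; rewrite mulr_ge0// divr_ge0// mulr_ge0 ?central_ge0//.
  exact: connector_ge0.
- case=> [|i].
    rewrite ltn0 mul0r; apply: eq_has_sum (has_sum0 R) => n.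
    by rewrite /f ltn0 mul0r.
  have := has_sumZ ((b < i.+1)%:R / i.+1%:R) (has_sum_central_connector R (ltn0Sn i)).
  rewrite /pair_weight invfM mulrA; apply: eq_has_sum => n.
  by rewrite /f mulrAC !mulrA.
- case=> [|n].
    rewrite /central mul0r !mul0r; apply: eq_has_sum (has_sum0 R) => i.
    by rewrite /f /central !mul0r mulr0.
  have := has_sumZ (central R n.+1) (has_sum_connector R b (ltn0Sn n)).
  rewrite -mulrA [_^-1 * _]mulrC; apply: eq_has_sum => i.
  by rewrite /f mulrCA !mulrA.
Qed.

Arguments has_sum_central_tail R b : clear implicits.

(** * Nested sums over even indices and their connector expansions *)

(* A hatted exponent keeps only even indices [2 b]: [hat_coef s b] is the part of
   the nested sum whose outermost index is [2 b], up to the factor [hat_scale s].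
   The empty word is given outermost index 0. *)
Fixpoint hat_coef (R : realType) (s : seq nat) (b : nat) : R :=
  match s with
  | [::] => (b == 0)%:R
  | e :: s' => (\sum_(0 <= c < b) hat_coef R s' c) / b%:R ^+ e
  end.

Definition hat_sum (R : realType) (s : seq nat) (i : nat) : R :=
  \sum_(0 <= c < i) hat_coef R s c.

Lemma hat_coef_ge0 (R : realType) s b : 0 <= hat_coef R s b.
Proof.
elim: s b => [|e s ih] b /=; first by [].
by rewrite divr_ge0 ?exprn_ge0// sumr_ge0.
Qed.

Lemma hat_sum_ge0 (R : realType) s i : 0 <= hat_sum R s i.
Proof. by apply: sumr_ge0 => c _; exact: hat_coef_ge0. Qed.

Lemma hat_coef0 (R : realType) e s : hat_coef R (e :: s) 0 = 0.
Proof. by rewrite /= big_geq// mul0r. Qed.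

(** The invariant of the transport: [y] is the factor still attached to [n], and [s] is the word of
    indices that it becomes on the other side of the connector. *)
Definition connects (R : realType) (s : seq nat) (y : R ^nat) :=
  forall n, (0 < n)%N -> has_sum (fun b => hat_coef R s b * connector R n b) (y n).

Lemma connects_nil (R : realType) : connects [::] (fun=> 1 : R).
Proof.
move=> n n0; have := @has_sum_finite R (fun b => hat_coef R [::] b * connector R n b) 1.
rewrite big_nat1 /= connectorn0 mulr1; apply => b.
by case: b => //= b _; rewrite mul0r.
Qed.

(** Each [C(n, c) / n] spreads over the indices [b > c]. Collecting the coefficient of [C(n, b)]
    gives the sum over [c < b], divided by [b], which prepends an exponent 1. *)
Lemma connects_one (R : realType) s (y : R ^nat) :
  connects s y -> connects (1%N :: s) (fun n => y n / n%:R).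
Proof.
move=> sy n n0.
pose f c b : R := hat_coef R s c * ((c < b)%:R * (connector R n b / b%:R)).
apply: (@has_sum_exchange _ f (fun c => n%:R^-1 * (hat_coef R s c * connector R n c))).
- by move=> c b; rewrite !mulr_ge0 ?hat_coef_ge0 ?invr_ge0 ?connector_ge0.
- move=> c; rewrite mulrC -mulrA; apply: has_sumZ.
  exact: has_sum_connector.
- move=> b; rewrite /= expr1.
  have -> : (\sum_(0 <= c < b) hat_coef R s c) / b%:R * connector R n b =
      \sum_(0 <= c < b) f c b.
    rewrite mulrAC -mulrA mulr_suml; apply: eq_big_nat => c /andP[_ cb].
    by rewrite /f cb mul1r.
  by apply: has_sum_finite => c; rewrite leqNgt /f => /negbTE ->; rewrite mul0r mulr0.
- by rewrite mulrC; apply: has_sumZ; exact: sy.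
Qed.

(** By symmetry of the connector, summing [C(k, b) / k] over [k > n] gives [C(n, b) / b]. The extra
    [1 / b] raises the leading exponent from 1 to 2. *)
Lemma connects_two (R : realType) s (y Y : R ^nat) :
  connects (1%N :: s) y ->
  (forall n, has_sum (fun k => (n < k)%:R * (y k / k%:R)) (Y n)) ->
  connects (2%N :: s) Y.
Proof.
move=> sy yY n n0.
have coefE b : hat_coef R (2%N :: s) b = hat_coef R (1%N :: s) b / b%:R.
  by rewrite /= expr1 expr2 invfM mulrA.
pose f k b : R :=
  hat_coef R (1%N :: s) b * ((n < k)%:R * (connector R k b / k%:R)).
apply: (@has_sum_exchange _ f _ _ _ _ _ _ (yY n)).
- move=> k b; apply: mulr_ge0; first exact: hat_coef_ge0.
  by rewrite !mulr_ge0 ?invr_ge0 ?connector_ge0.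
- move=> k; have [nk|nk] := ltnP n k; last first.
    rewrite mul0r; apply: eq_has_sum (has_sum0 R) => b.
    by rewrite /f ltnNge nk mul0r mulr0.
  have := has_sumZ (k%:R^-1) (sy k (leq_ltn_trans (leq0n _) nk)).
  rewrite mul1r [_^-1 * _]mulrC; apply: eq_has_sum => b.
  by rewrite /f nk mul1r [LHS]mulrC mulrA.
(* The symmetric telescoping needs [b > 0]; at [b = 0] the coefficient of a nonempty word
   vanishes. *)
- move=> b; rewrite coefE; case: b => [|b].
    rewrite hat_coef0 !mul0r; apply: eq_has_sum (has_sum0 R) => k.
    by rewrite /f hat_coef0 mul0r.
  rewrite -mulrA [_^-1 * _]mulrC [connector R n _]connectorC.
  have := has_sumZ (hat_coef R (1%N :: s) b.+1) (has_sum_connector R n (ltn0Sn b)).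
  by apply: eq_has_sum => k; rewrite /f connectorC.
Qed.

(** Two interchanges: summing over [n] first turns each connector into [pair_tail R b]; unfolding
    that tail over [i > b] and summing over [b] first produces [hat_sum]. *)
Lemma has_sum_pair_hat (R : realType) s (y : R ^nat) X :
  connects s y -> (forall n, 0 <= y n) ->
  has_sum (fun n => central R n / n%:R * y n) X ->
  has_sum (fun i => pair_weight R i * hat_sum R s i) X.
Proof.
move=> sy y0 yX.
have cn0 n : 0 <= central R n / n%:R by rewrite divr_ge0 ?central_ge0.
pose f n b : R := central R n / n%:R * (hat_coef R s b * connector R n b).
have : has_sum (fun b => hat_coef R s b * pair_tail R b) X.
  apply: (@has_sum_exchange _ f _ _ _ _ _ _ yX).
  - by move=> n b; rewrite !mulr_ge0 ?hat_coef_ge0 ?invr_ge0 ?connector_ge0 ?central_ge0.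
  - case=> [|n]; last by apply: has_sumZ; exact: sy.
    rewrite /central !mul0r; apply: eq_has_sum (has_sum0 R) => b.
    by rewrite /f /central !mul0r.
  - move=> b; have := has_sumZ (hat_coef R s b) (has_sum_central_tail R b).
    by apply: eq_has_sum => n; rewrite /f mulrCA.
pose g b i : R := hat_coef R s b * ((b < i)%:R * pair_weight R i).
apply: (@has_sum_exchange _ g).
- by move=> b i; rewrite !mulr_ge0 ?hat_coef_ge0 ?pair_weight_ge0.
- by move=> b; apply: has_sumZ; exact: has_sum_pair_tail.
- move=> i.
  have -> : pair_weight R i * hat_sum R s i = \sum_(0 <= b < i) g b i.
    rewrite mulrC mulr_suml; apply: eq_big_nat => c /andP[_ cb].
    by rewrite /g cb mul1r.
  by apply: has_sum_finite => c; rewrite leqNgt /g => /negbTE ->; rewrite mul0r mulr0.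
Qed.

(** * Truncated multiple zeta values and their limits *)

Lemma cvg_hat_sum (R : realType) s : hat_coef R s @ \oo --> 0 ->
  (fun i => hat_sum R s i.+1 / i.+1%:R) @ \oo --> 0.
Proof. by move=> /cesaro; under eq_fun do rewrite /= mulrC. Qed.

(** An exponent [e >= 1] bounds the coefficient by a Cesaro mean of those of the shorter word, which
    tends to 0 by induction. *)
Lemma cvg_hat_coef (R : realType) s : all (leq 1) s -> hat_coef R s @ \oo --> 0.
Proof.
elim: s => [_|e s ih /= /andP[e0 /ih{}ih]].
  by rewrite -(cvg_shiftn 1); under eq_fun do rewrite addn1; exact: cvg_cst.
rewrite -(cvg_shiftn 1); under eq_fun do rewrite addn1.
apply: (@squeeze_cvgr _ _ _ _ (cst 0) (fun i => hat_sum R s i.+1 / i.+1%:R)).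
- apply: nearW => i; rewrite /= -/(hat_sum R s i.+1).
  rewrite divr_ge0 ?hat_sum_ge0 ?exprn_ge0//=.
  apply: ler_wpM2l; first exact: hat_sum_ge0.
  by rewrite lef_pV2 ?posrE ?exprn_gt0// ?ltr0n// ler_eXnr ?ler1n.
- exact: cvg_cst.
- exact: cvg_hat_sum.
Qed.

(** At an even index [2 * b], the sign contributes 2 and the denominator [2 ^+ e]. *)
Definition hat_scale (R : realType) (s : seq nat) : R := \prod_(e <- s) (2 / 2 ^+ e).

(** Odd indices have sign 0, so both bounds admit the same indices [2 * b] with [b <= i]. *)
Lemma mzv_below_hat (R : realType) s i :
  mzv_below R (map hat s) (2 * i + 1) = hat_scale R s * hat_sum R s i.+1 /\
  mzv_below R (map hat s) (2 * i + 2) = hat_scale R s * hat_sum R s i.+1.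
Proof.
elim: s i => [|e s ih] i.
  have -> : hat_sum R [::] i.+1 = 1.
    by rewrite /hat_sum big_nat_recl//= big1 ?addr0.
  by rewrite /hat_scale big_nil mulr1.
have even_sign k : mzv_sign R Hat (2 * k) = 2.
  by rewrite /= exprM sqrrN expr1n expr1n.
have odd_term k : mzv_sign R Hat (2 * k + 1) = 0.
  by rewrite /= exprD exprM sqrrN expr1n expr1n mul1r expr1 subrr.
elim: i => [|i [_ ihi]].
  have -> : hat_sum R (e :: s) 1 = 0 by rewrite /hat_sum big_nat1 hat_coef0.
  rewrite mulr0 /= muln0 !add0n; split; first by rewrite big_geq.
  by rewrite big_nat1 expr1 subrr !mul0r.
have step N : (0 < N)%N -> mzv_below R (map hat (e :: s)) N.+1 =
  mzv_below R (map hat (e :: s)) N +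
  mzv_sign R Hat N / N%:R ^+ e * mzv_below R (map hat s) N.
  by move=> N0 /=; rewrite big_nat_recr.
have evenE : mzv_below R (map hat (e :: s)) (2 * i.+1 + 1) =
    hat_scale R (e :: s) * hat_sum R (e :: s) i.+2.
  rewrite addn1 step// even_sign (_ : (2 * i.+1 = 2 * i + 2)%N); last lia.
  rewrite ihi (ih i).2 [hat_sum R _ i.+2]big_nat_recr//= -/(hat_sum R s i.+1) mulrDr.
  congr (_ + _); rewrite /hat_scale big_cons (_ : (2 * i + 2 = 2 * i.+1)%N); last lia.
  by rewrite natrM exprMn invfM; ring.
split=> //; have -> : (2 * i.+1 + 2 = (2 * i.+1 + 1).+1)%N by lia.
by rewrite step ?addn1// -addn1 odd_term !mul0r addr0.
Qed.

Lemma mzv_below_barS (R : realType) t N : (0 < N)%N ->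
  mzv_below R (bar 1 :: t) N.+1 =
  mzv_below R (bar 1 :: t) N + (-1) ^+ N / N%:R * mzv_below R t N.
Proof. by move=> N0 /=; rewrite big_nat_recr. Qed.

(** An odd bound leaves only complete pairs. The two terms of a pair share the same inner sum, and
    with [x = i + 1] their coefficients add up to [- 1 / (2x - 1) + 1 / (2x)], that is, minus half
    of the pair weight. *)
Lemma mzv_below_bar_odd (R : realType) s i :
  mzv_below R (bar 1 :: map hat s) (2 * i + 1) =
  - (hat_scale R s / 2) * series (fun i => pair_weight R i * hat_sum R s i) i.+1.
Proof.
elim: i => [|i ih].
  rewrite /= big_geq// /series /= big_nat1 /hat_sum [X in _ * (_ * X)]big_geq//.
  by rewrite !mulr0.
have -> : (2 * i.+1 + 1 = (2 * i + 2).+1)%N by lia.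
rewrite mzv_below_barS; last lia.
rewrite {1}(_ : (2 * i + 2 = (2 * i + 1).+1)%N); last lia.
rewrite mzv_below_barS; last lia.
rewrite ih (mzv_below_hat R s i).1 (mzv_below_hat R s i).2.
rewrite [in RHS]/series /= big_nat_recr//= -/(series _ i.+1).
have -> : (-1) ^+ (2 * i + 1) = -1 :> R.
  by rewrite exprD exprM sqrrN expr1n expr1n mul1r.
have -> : (-1) ^+ (2 * i + 2) = 1 :> R.
  by rewrite exprD exprM sqrrN !expr1n mul1r.
have -> : (2 * i + 2)%:R = 2 * i.+1%:R :> R by rewrite -natrM; congr _%:R; lia.
have -> : (2 * i + 1)%:R = 2 * i.+1%:R - 1 :> R.
  by rewrite -natrM -[1]/(1%:R) -natrB; [congr _%:R; lia | lia].
have i1 : 1 <= i.+1%:R :> R by rewrite ler1n.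
rewrite /pair_weight mulrDr -addrA; congr (_ + _).
move: (i.+1%:R : R) i1 => x x1.
by field; rewrite !gt_eqF//; lra.
Qed.

Lemma cvg_parity (R : realType) (u : R ^nat) (l : R) :
  (fun i => u (2 * i + 1)%N) @ \oo --> l -> (fun i => u (2 * i + 2)%N) @ \oo --> l ->
  u @ \oo --> l.
Proof.
move=> /cvgrPdist_lt ho /cvgrPdist_lt he; apply/cvgrPdist_lt => e e0.
have [N _ hN] := ho e e0; have [M _ hM] := he e e0.
(* An even [n] beyond this threshold is at least [2 * (N + M) + 2], so [n./2 - 1] still reaches
   [M]. *)
exists (2 * (N + M) + 1)%N => // n /= Nn.
have := odd_double_half n; rewrite -mul2n; case: (odd n) => /= En.
  rewrite -En addnC; apply: hN => /=; lia.
have -> : n = (2 * (n./2 - 1) + 2)%N by lia.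
apply: hM => /=; lia.
Qed.

Lemma cvg_mzv_below_bar (R : realType) s X : all (leq 1) s ->
  has_sum (fun i => pair_weight R i * hat_sum R s i) X ->
  mzv_below R (bar 1 :: map hat s) @ \oo --> - (hat_scale R s / 2) * X.
Proof.
move=> s1 sX.
have odd_cvg : (fun i => mzv_below R (bar 1 :: map hat s) (2 * i + 1)) @ \oo -->
    - (hat_scale R s / 2) * X.
  under eq_fun do rewrite mzv_below_bar_odd; apply: cvgMl_tmp.
  have := sX; rewrite /has_sum -(cvg_shiftn 1).
  by under eq_fun do rewrite addn1.
apply: cvg_parity => //.
have scale0 : 0 <= hat_scale R s.
  by apply: prodr_ge0 => e _; rewrite divr_ge0// exprn_ge0.
(* Up to sign, the unpaired term [n_1 = 2i + 1] of the truncation at [2i + 2]; it vanishes in the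
   limit by the Cesaro bound. *)
pose d i : R := hat_scale R s * hat_sum R s i.+1 / (2 * i + 1)%:R.
have d0 : d @ \oo --> 0.
  apply: (@squeeze_cvgr _ _ _ _ (cst 0)
    (fun i => hat_scale R s * (hat_sum R s i.+1 / i.+1%:R))).
  - apply: nearW => i; rewrite /d /= -mulrA.
    rewrite !mulr_ge0 ?hat_sum_ge0 ?invr_ge0//=.
    apply: ler_wpM2l => //; apply: ler_wpM2l; first exact: hat_sum_ge0.
    by rewrite lef_pV2 ?posrE ?ltr0n ?addn1// ler_nat; lia.
  - exact: cvg_cst.
  - rewrite -(mulr0 (hat_scale R s)); apply: cvgMl_tmp.
    by apply: cvg_hat_sum; exact: cvg_hat_coef.
have -> : (fun i => mzv_below R (bar 1 :: map hat s) (2 * i + 2)) =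
    (fun i => mzv_below R (bar 1 :: map hat s) (2 * i + 1) - d i).
  apply/funext => i; have -> : (2 * i + 2 = (2 * i + 1).+1)%N by lia.
  rewrite mzv_below_barS; last by rewrite addn1.
  rewrite (mzv_below_hat R s i).1 /d.
  rewrite exprD exprM sqrrN !expr1n mul1r expr1 mulN1r mulNr.
  by rewrite [_^-1 * _]mulrC.
have : (fun i => mzv_below R (bar 1 :: map hat s) (2 * i + 1) - d i) @ \oo -->
    - (hat_scale R s / 2) * X - 0 by exact: cvgB.
by rewrite subr0.
Qed.

(** * Zeta values and their tails *)

Definition zeta_term (R : realType) (s k : nat) : R := (k%:R ^+ s)^-1.

Lemma mzv_below_plain (R : realType) s : (0 < s)%N ->
  mzv_below R [:: plain s] = series (zeta_term R s).
Proof.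
move=> s0; apply/funext => -[|N]; first by rewrite /series /= !big_geq.
(* The series also has an index 0, whose term is the inverse of 0, hence 0. *)
rewrite /series /= [RHS]big_ltn// /zeta_term expr0n gtn_eqF//= invr0 add0r.
by apply: eq_bigr => n _; rewrite mul1r mulr1.
Qed.

(** For [k >= 1], [k^-s <= k^-2 <= 1 / (k (k - 1/2))], which is twice the pair weight. *)
Lemma has_sum_zeta (R : realType) s : (1 < s)%N ->
  has_sum (zeta_term R s) (mzv R [:: plain s]).
Proof.
move=> s1; rewrite /mzv mzv_below_plain ?(ltn_trans _ s1)//.
apply: has_sum_le (has_sumZ 2 (has_sum_pair_weight R)) => k.
rewrite /zeta_term invr_ge0 exprn_ge0//=; case: k => [|k].
  by rewrite expr0n gtn_eqF ?(ltn_trans _ s1)//= invr0 mulr_ge0 ?pair_weight_ge0.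
have k1 : 1 <= k.+1%:R :> R by rewrite ler1n.
apply: (@le_trans _ _ (k.+1%:R ^+ 2)^-1).
  by rewrite lef_pV2 ?posrE ?exprn_gt0// ?ltr0n//; apply: ler_weXn2l.
rewrite /pair_weight; move: (k.+1%:R : R) k1 => x x1.
have -> : 2 * (x * (2 * x - 1))^-1 = (x * (x - 2^-1))^-1.
  by field; rewrite !gt_eqF//; lra.
by rewrite lef_pV2 ?posrE; nra.
Qed.

Arguments has_sum_zeta R {s} _.

Lemma has_sum_zeta_tail (R : realType) s n : (1 < s)%N ->
  has_sum (fun k => (n < k)%:R * zeta_term R s k)
    (mzv R [:: plain s] - gen_harmonic R s n).
Proof.
move=> s1.
have h : has_sum (fun k => (k <= n)%:R * zeta_term R s k) (gen_harmonic R s n).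
  have -> : gen_harmonic R s n =
      \sum_(0 <= k < n.+1) ((k <= n)%:R * zeta_term R s k).
    rewrite [RHS]big_ltn// /zeta_term expr0n gtn_eqF ?(ltn_trans _ s1)//=.
    rewrite invr0 mulr0 add0r; apply: eq_big_nat => k /andP[_].
    by rewrite ltnS => ->; rewrite mul1r.
  by apply: has_sum_finite => k; rewrite ltnNge => /negbTE ->; rewrite mul0r.
apply: eq_has_sum (has_sumB (has_sum_zeta R s1) h) => k.
by rewrite leqNgt; case: ltnP => _ /=; rewrite ?mul0r ?mul1r ?subr0 ?subrr.
Qed.

Arguments has_sum_zeta_tail R {s} n _.

(** * Runs of ones and the final identity *)

Lemma connects_ones (R : realType) s (y : R ^nat) p :
  connects s y -> connects (nseq p 1%N ++ s) (fun n => y n / n%:R ^+ p).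
Proof.
move=> sy; elim: p => [|p ih] /=.
  by move=> n n0; rewrite expr0 divr1; exact: sy.
move=> n n0; rewrite exprSr invfM mulrA; exact: (connects_one ih).
Qed.

Lemma hat_scale_ones (R : realType) p s :
  hat_scale R (nseq p 1%N ++ s) = hat_scale R s.
Proof.
elim: p => //= p ih; rewrite /hat_scale big_cons -/(hat_scale R _) ih.
by rewrite divff ?mul1r.
Qed.

Theorem theorem2p3 (R : realType) (m p : nat) (hm : (1 <= m)%N) :
  [/\ cvgn (mzv_below R (bar 1 :: nseq p (hat 1) ++ hat 2 :: nseq (m - 1) (hat 1))),
      cvgn (mzv_below R [:: plain (m + 1)]),
      cvgn (mzv_below R (bar 1 :: nseq p (hat 1))) &
      \sum_(1 <= n < N)
          (gen_harmonic R (m + 1) n * 'C(2 * n, n)%:R / (4 ^+ n * n%:R ^+ (p + 1)))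
        @[N --> \oo] -->
        4 * mzv R (bar 1 :: nseq p (hat 1) ++ hat 2 :: nseq (m - 1) (hat 1))
        - 2 * mzv R [:: plain (m + 1)] * mzv R (bar 1 :: nseq p (hat 1))].
Proof.
have m1 : (1 < m + 1)%N by rewrite addn1 ltnS.
pose s1 := nseq p 1%N ++ [::].
pose s2 := nseq p 1%N ++ 2%N :: nseq (m - 1) 1%N ++ [::].
have -> : nseq p (hat 1) ++ hat 2 :: nseq (m - 1) (hat 1) = map hat s2.
  by rewrite /s2 cats0 map_cat /= !map_nseq.
have -> : nseq p (hat 1) = map hat s1 by rewrite /s1 cats0 map_nseq.
set z := mzv R [:: plain (m + 1)].
pose tail n := z - gen_harmonic R (m + 1) n.
pose y1 n : R := 1 / n%:R ^+ p; pose y2 n : R := tail n / n%:R ^+ p.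
have conn1 : connects s1 y1 by apply: connects_ones; exact: connects_nil.
have conn2 : connects s2 y2.
  (* The word of [m] ones carries [k^-m]; dividing by [k] and summing over [k > n], as
     [connects_two] does, yields the tail of the zeta series. *)
  have conn1m : connects (1%N :: nseq (m - 1) 1%N ++ [::])
      (fun n => 1 / n%:R ^+ (m - 1) / n%:R : R).
    by apply: connects_one; apply: connects_ones; exact: connects_nil.
  apply: connects_ones; apply: (connects_two conn1m) => n.
  apply: eq_has_sum (has_sum_zeta_tail R n m1) => k.
  rewrite /zeta_term (_ : (m + 1 = (m - 1).+2)%N); last lia.
  by rewrite !exprSr !invfM mul1r; ring.
have c0 n : 0 <= central R n / n%:R by rewrite divr_ge0 ?central_ge0.
have tail0 n : 0 <= tail n <= z.
  apply/andP; split; last first.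
    by rewrite gerBl; apply: sumr_ge0 => k _; rewrite invr_ge0 exprn_ge0.
  apply: has_sum_ge0 (has_sum_zeta_tail R n m1) => k.
  by rewrite mulr_ge0 ?invr_ge0 ?exprn_ge0.
have y10 n : 0 <= y1 n by rewrite divr_ge0 ?exprn_ge0.
have y2E n : y2 n = tail n * y1 n by rewrite /y1 mul1r.
have y20 n : 0 <= y2 n by case/andP: (tail0 n) => *; rewrite y2E mulr_ge0.
have [X1 hX1] : exists X, has_sum (fun n => central R n / n%:R * y1 n) X.
  (* Since [C(n, 0) = 1] and [y1 n <= 1], the case [b = 0] of the central tail dominates. *)
  eexists; apply: has_sum_le (has_sum_central_tail R 0) => n.
  rewrite mulr_ge0//= connectorn0 ler_wpM2l//.
  rewrite /y1 mul1r; case: n => [|n].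
    by rewrite expr0n; case: eqP => _; rewrite ?invr1 ?invr0 ?ler01.
  by rewrite invf_le1 ?exprn_gt0 ?ltr0n// exprn_ege1// ler1n.
have [X2 hX2] : exists X, has_sum (fun n => central R n / n%:R * y2 n) X.
  eexists; apply: has_sum_le (has_sumZ z hX1) => n.
  rewrite mulr_ge0//= [leRHS]mulrCA ler_wpM2l// y2E ler_wpM2r//.
  by case/andP: (tail0 n).
have lim1 : mzv_below R (bar 1 :: map hat s1) @ \oo --> - 2^-1 * X1.
  have -> : - 2^-1 = - (hat_scale R s1 / 2).
    by rewrite hat_scale_ones /hat_scale big_nil mul1r.
  apply: cvg_mzv_below_bar; last exact: has_sum_pair_hat conn1 y10 hX1.
  by rewrite /s1 cats0 all_nseq orbT.
have lim2 : mzv_below R (bar 1 :: map hat s2) @ \oo --> - 4^-1 * X2.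
  (* The exponent 2 contributes [2 / 2^2 = 1/2] and every exponent 1 contributes 1; pairing gives
     the other factor 1/2. *)
  have -> : - 4^-1 = - (hat_scale R s2 / 2).
    rewrite hat_scale_ones /hat_scale big_cons -/(hat_scale R _) hat_scale_ones.
    by rewrite /hat_scale big_nil; field.
  apply: cvg_mzv_below_bar; last exact: has_sum_pair_hat conn2 y20 hX2.
  by rewrite /s2 cats0 all_cat /= !all_nseq !orbT.
have limz := has_sum_zeta R m1.
split; [by apply/cvg_ex; exists (- 4^-1 * X2)| |
  by apply/cvg_ex; exists (- 2^-1 * X1)|].
  by rewrite mzv_below_plain ?(ltn_trans _ m1)//; apply/cvg_ex; exists z.
have -> : mzv R (bar 1 :: map hat s1) = - 2^-1 * X1 by exact: cvg_lim lim1.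
have -> : mzv R (bar 1 :: map hat s2) = - 4^-1 * X2 by exact: cvg_lim lim2.
have -> : 4 * (- 4^-1 * X2) - 2 * z * (- 2^-1 * X1) = z * X1 - X2 by field.
(* Termwise this is [H_n = z - tail n]; the index 0 adds nothing because [central] vanishes
   there. *)
suff -> : (fun N => \sum_(1 <= n < N) (gen_harmonic R (m + 1) n *
      'C(2 * n, n)%:R / (4 ^+ n * n%:R ^+ (p + 1)))) =
    series (fun n => z * (central R n / n%:R * y1 n) - central R n / n%:R * y2 n).
  exact: has_sumB (has_sumZ z hX1) hX2.
apply/funext => -[|N]; rewrite /series /=; first by rewrite !big_geq.
rewrite [RHS]big_ltn// /central !mul0r mulr0 subr0 add0r.
apply: eq_big_nat => n /andP[n1 _].
rewrite n1 mul1r y2E /tail /y1 exprD expr1.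
have : n%:R != 0 :> R by rewrite pnatr_eq0 -lt0n.
have : n%:R ^+ p != 0 :> R by rewrite expf_neq0// pnatr_eq0 -lt0n.
have : 4 ^+ n != 0 :> R by rewrite expf_neq0// pnatr_eq0.
move: (4 ^+ n) (n%:R) (n%:R ^+ p) => c b a c1 a1 b1.
by field; rewrite a1 b1 c1.
Qed.
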